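(* Let $G$ be a graph having two vertices $u$ and $v$ with $\deg(u)=1$, $\deg(v)=2$ and $d(u,v)=2$, and let $H$ be a graph with at least one pendant vertex. Then the direct product $G\times H$ is not group vertex magic.
   Context: Graphs are finite, simple and undirected; $d(u,v)$ is the distance. For an additive Abelian group $\Gamma$ with identity $0$ and a graph $G$, a $\Gamma$-vertex magic labeling is a map $\ell:V(G)\to\Gamma\setminus\{0\}$ for which there is $\mu\in\Gamma$ with $w(v)=\sum_{u\in N(v)}\ell(u)=\mu$ for every vertex $v$; $G$ is group vertex magic if it is $\Gamma$-vertex magic for every nontrivial Abelian group $\Gamma$. A pendant vertex has degree $1$. The direct product $G\times H$ has vertex set $V(G)\times V(H)$ with $(g,h)\sim(g',h')$ iff $gg'\in E(G)$ and $hh'\in E(H)$. *)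

(* Defs.v *)
From HB Require Import structures.
From mathcomp Require Import all_boot all_order all_algebra.

Set Implicit Arguments.
Unset Strict Implicit.
Unset Printing Implicit Defensive.

Import GRing.Theory.
Local Open Scope ring_scope.

Record sgraph := SGraph {
  vertex :> finType;
  adj : rel vertex;
  adj_sym : symmetric adj;
  adj_irr : irreflexive adj }.

Arguments adj {s} _ _.

Definition nbh (G : sgraph) (v : G) : {set G} := [set u | adj v u].

Definition deg (G : sgraph) (v : G) : nat := #|nbh v|.

Definition pendant (G : sgraph) (v : G) : Prop := deg v = 1%N.

(* A walk from u to v is encoded by its vertex sequence u :: p, of length
   size p.  The distance is relational because it is infinite (so equal to no
   natural number) when u and v are not connected. *)
Definition is_walk (G : sgraph) (u v : G) (p : seq G) : Prop :=
  path adj u p /\ last u p = v.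

Definition is_dist (G : sgraph) (u v : G) (n : nat) : Prop :=
  (exists2 p : seq G, is_walk u v p & size p = n) /\
  (forall p : seq G, is_walk u v p -> (n <= size p)%N).

Section DirectProduct.
Variables G H : sgraph.

Definition dprod_adj : rel (G * H)%type :=
  fun x y => adj x.1 y.1 && adj x.2 y.2.

Lemma dprod_adj_sym : symmetric dprod_adj.
Proof. by move=> x y; rewrite /dprod_adj adj_sym (adj_sym x.2). Qed.

Lemma dprod_adj_irr : irreflexive dprod_adj.
Proof. by move=> x; rewrite /dprod_adj adj_irr. Qed.

Definition direct_product : sgraph := SGraph dprod_adj_sym dprod_adj_irr.

End DirectProduct.

Definition weight (Gamma : zmodType) (G : sgraph) (l : G -> Gamma) (v : G) :
  Gamma := \sum_(u in nbh v) l u.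

Definition vertex_magic_labeling (Gamma : zmodType) (G : sgraph)
    (l : G -> Gamma) : Prop :=
  (forall v : G, l v != 0) /\ exists mu : Gamma, forall v : G, weight l v = mu.

Definition vertex_magic (Gamma : zmodType) (G : sgraph) : Prop :=
  exists l : G -> Gamma, vertex_magic_labeling l.

Definition nontrivial (Gamma : zmodType) : Prop := exists x : Gamma, x != 0.

Definition group_vertex_magic (G : sgraph) : Prop :=
  forall Gamma : zmodType, nontrivial Gamma -> vertex_magic Gamma G.

(* Main.v *)
Require Import Defs.
From HB Require Import structures.
From mathcomp Require Import all_boot all_order all_algebra.

Import GRing.Theory.

(** Let [q] be the sole neighbour of the pendant vertex [p], [c] that of [u]; since [d(u,v) = 2],
    [c] is also a neighbour of [v], whose other neighbour is [d]. In the product, [(u, p)] sees only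
    [(c, q)], while [(v, p)] sees [(c, q)] and [(d, q)]. Equal weights force the label of [(d, q)]
    to be 0, which is forbidden. *)

Lemma is_dist2_common_nbh (G : sgraph) (u v : G) :
  is_dist u v 2 -> exists2 c, c \in nbh u & c \in nbh v.
Proof.
case=> [[[|c [|z []]] // [/= /and3P[uc cz _] zv] _] _].
by exists c; rewrite inE // adj_sym -zv.
Qed.

(** A step from [p] can only lead to [q], so the neighbourhood of [(x, p)] is a copy of that of [x]
    in the layer over [q]. *)
Lemma weight_direct_product_pendant (Gamma : zmodType) (G H : sgraph)
    (l : direct_product G H -> Gamma) (x : G) (p q : H) :
  nbh p = [set q] ->
  weight l ((x, p) : direct_product G H) = (\sum_(a in nbh x) l (a, q))%R.
Proof.
move=> Np; rewrite /weight.
have -> : nbh ((x, p) : direct_product G H) = [set (a, q) | a in nbh x].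
  apply/setP=> -[a b]; rewrite inE /= /dprod_adj /=.
  have -> : adj p b = (b == q) by rewrite -in_set1 -Np inE.
  apply/andP/imsetP => [[xa /eqP->]|[c]]; first by exists a; rewrite ?inE.
  by rewrite inE => xc [-> ->].
by rewrite big_imset //= => a b _ _ [].
Qed.

Theorem theorem3p13 (G H : sgraph) (u v : G)
  (hu : deg u = 1%N) (hv : deg v = 2%N) (huv : is_dist u v 2%N)
  (hH : exists p : H, pendant p) :
  ~ group_vertex_magic (direct_product G H).
Proof.
move=> magic.
have [p /eqP/cards1P[q Np]] := hH.
(* One group without a labeling suffices; the integers serve, and the argument below uses only
   cancellation. *)
have int_nontrivial : nontrivial int by exists 1%R.
have [l [l_neq0 [mu l_mu]]] := magic int int_nontrivial.
have [c cu cv] := is_dist2_common_nbh _ _ _ huv.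
have /eqP/cards1P[c' Nu] := hu.
move: cu; rewrite Nu inE => /eqP def_c; subst c'.
have /eqP/cards1P[d Nv] : #|nbh v :\ c| = 1%N.
  by have := cardsD1 c (nbh v); rewrite cv -/(deg v) hv => -[].
have := l_mu (u, p); rewrite (weight_direct_product_pendant _ _ _ _ _ _ _ Np).
rewrite Nu big_set1 => wu.
have := l_mu (v, p); rewrite (weight_direct_product_pendant _ _ _ _ _ _ _ Np).
(* Substituting [wu] leaves [mu + l (d, q) = mu]. *)
rewrite (big_setD1 c) //= Nv big_set1 wu => /eqP.
by rewrite -subr_eq0 addrAC subrr add0r (negbTE (l_neq0 _)).
Qed.
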